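(* Let $G$ be a modular abelian independence group, and let $A$ be a flat of finite rank. Then $A$ is self-matched if and only if $1\notin A$.
   Context: A finitary matroid is a pair $(E,\mathcal{I})$ consisting of a set $E$ and a nonempty collection $\mathcal{I}$ of subsets of $E$ (called the independent sets) such that: (I1) if $A\in\mathcal{I}$ and $B\subseteq A$ then $B\in\mathcal{I}$; (I2) if $A,B$ are finite elements of $\mathcal{I}$ with $|B|=|A|+1$, then there is $x\in B\setminus A$ with $\{x\}\cup A\in\mathcal{I}$; (I3) if $A\subseteq E$ and every finite subset of $A$ belongs to $\mathcal{I}$, then $A\in\mathcal{I}$. The collection $\mathcal{I}$ is called an independence structure on $E$. A basis of a subset $A\subseteq E$ is an inclusion-maximal independent subset of $A$; any two bases of $A$ have the same cardinality, and the rank $\rho(A)$ is that cardinal number; $A$ has finite rank if $\rho(A)$ is a nonnegative integer. An element $x\in E$ depends on $A\subseteq E$ if either $x\in A$, or $x\notin A$ and $\{x\}\cup B\notin\mathcal{I}$ for some independent $B\subseteq A$. The closure is $\operatorname{cl}(A)=\{x\in E: x\text{ depends on }A\}$, and $A$ is a flat if $\operatorname{cl}(A)=A$. The finitary matroid is modular if $\rho(A)+\rho(B)=\rho(A\cup B)+\rho(A\cap B)$ (as cardinals) for all flats $A,B$. An independence group is a group $G$ (written multiplicatively, with identity $1$) together with an independence structure $\mathcal{I}$ on the set $G$ such that for every $g\in G$ and $A\subseteq G$ one has $gA\in\mathcal{I}$ if and only if $A\in\mathcal{I}$, where $gA=\{gx:x\in A\}$. A modular abelian independence group is an independence group that is modular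 as a finitary matroid and whose group is abelian. Let $A,B$ be subsets of $G$ with $\rho(A)=\rho(B)$ finite. $A$ is matched to $B$ (the pair $(A,B)$ is matched) if for every basis $\mathcal{A}$ of $A$ and every basis $\mathcal{B}$ of $B$ there exists a bijection $f:\mathcal{A}\to\mathcal{B}$ such that $af(a)\notin A$ for all $a\in\mathcal{A}$. A finite-rank subset $A$ is self-matched if the pair $(A,A)$ is matched.
   Formalization: The formal theorem additionally assumes that some nonempty subset of G is independent; if only the empty set is independent, the sole flat is G, which has rank 0, contains 1 and is vacuously self-matched, so the claim as printed fails. *)

(* Defs.v *)
From mathcomp Require Import all_boot.
From mathcomp Require Import boolp classical_sets functions cardinality.

Set Implicit Arguments.
Unset Strict Implicit.
Unset Printing Implicit Defensive.

Local Open Scope classical_set_scope.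
Local Open Scope card_scope.

(* The ground set is the whole type E. *)
Record finitary_matroid (E : Type) := FinitaryMatroid {
  indep : set (set E);
  indep_nonempty : indep !=set0;
  indep_subset : forall A B, indep A -> B `<=` A -> indep B;
  indep_augment : forall n A B, indep A -> indep B ->
    A #= `I_n -> B #= `I_n.+1 ->
    exists2 x, (B `\` A) x & indep (x |` A);
  indep_finitary : forall A,
    (forall B, finite_set B -> B `<=` A -> indep B) -> indep A
}.

Section Matroid.
Context (E : Type) (M : finitary_matroid E).
Implicit Types A B X Y : set E.

Definition is_basis A X :=
  [/\ X `<=` A, indep M X
    & forall Y, indep M Y -> Y `<=` A -> X `<=` Y -> Y = X].

Lemma exists_basis A : exists X, is_basis A X.
Proof.
have M0 : indep M set0.
  by have [X MX] := indep_nonempty M; exact: indep_subset MX _.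
have [|X [[MX XA] Xmax]] := @Zorn_bigcup E [set X | indep M X /\ X `<=` A].
  move=> F FA Ftot; split; last by move=> x [X /FA[_ XA] /XA].
  apply: indep_finitary => B finB BF.
  have [Fn0|F0] := pselect (F !=set0); last first.
    by apply: indep_subset M0 _ => x /BF[X FX]; case: F0; exists X.
  suff [X FX BX] : exists2 X, F X & B `<=` X.
    by have [MX _] := FA _ FX; exact: indep_subset MX BX.
  have /(@finite_seqP {classic E})[s sB] := finB.
  rewrite {}sB {B finB} in BF *.
  elim: s BF => [_|x s IHs sF]; first by have [X FX] := Fn0; exists X.
  have [|X {}FX sX] := IHs.
    by move=> y ys; apply: sF; rewrite /= inE ys orbT.
  have [|Y FY Yx] := sF x; first by rewrite /= inE eqxx.
  have [XY|YX] := Ftot _ _ FX FY.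
    by exists Y => // y; rewrite /= inE => /predU1P[->|/sX/XY].
  by exists X => // y; rewrite /= inE => /predU1P[->|/sX]//; exact: YX.
exists X; split=> // Y MY YA XY; apply: contrapT => YX.
by apply: (Xmax Y) => //; rewrite properEneq; split=> //; apply/eqP => /esym.
Qed.

(* A cardinal number is represented by a set having that cardinality, so ranks
   are compared with #= rather than =.  The choice of the basis is immaterial:
   all bases of A are equipotent. *)
Definition rank A : set E := get [set X | is_basis A X].

Lemma rankP A : is_basis A (rank A).
Proof. exact: getPex (exists_basis A). Qed.

Definition finite_rank A := finite_set (rank A).

Definition depends (x : E) A :=
  A x \/ ~ A x /\ exists B, [/\ indep M B, B `<=` A & ~ indep M (x |` B)].

Definition cl A := [set x | depends x A].

Definition flat A := cl A = A.

(* The sum of two cardinals is the cardinality of the disjoint union. *)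
Definition card_sum X Y : set (E + E) := inl @` X `|` inr @` Y.

Definition modular := forall A B, flat A -> flat B ->
  card_sum (rank A) (rank B) #= card_sum (rank (A `|` B)) (rank (A `&` B)).

End Matroid.

Section IndependenceGroup.
Local Open Scope group_scope.
Context (G : groupType) (M : finitary_matroid G).
Implicit Types A B : set G.

Definition is_independence_group :=
  forall (g : G) A, indep M [set g * x | x in A] <-> indep M A.

Definition matched A B :=
  [/\ finite_rank M A, rank M A #= rank M B
    & forall X Y, is_basis M A X -> is_basis M B Y ->
      exists f : G -> G, set_bij X Y f /\ forall a, X a -> ~ A (a * f a)].

Definition self_matched A := matched A A.

End IndependenceGroup.

(* Main.v *)
Require Import Defs.
From mathcomp Require Import all_boot finmap.
From mathcomp Require Import boolp classical_sets functions cardinality.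

Set Implicit Arguments.
Unset Strict Implicit.
Unset Printing Implicit Defensive.

Local Open Scope classical_set_scope.
Local Open Scope group_scope.

(** If [1] lies in [A], extend [{1}] to a basis [X] of [A] and match [X] to
itself by [f]: the element [a] with [f a = 1] gives [a * f a = a], which lies
in [A].  So a self-matched flat avoids [1].

Conversely let [A] be a flat of rank [n] avoiding [1], with bases [X] and [Y].
By Hall's theorem a matching exists as soon as every [J] contained in [X] has
at least [#|J|] partners in [Y], a partner being some [y] with [a * y] outside
[A] for some [a] in [J].  The elements of [Y] that are not partners lie in
[U = {u in A | u J is contained in A}], and [J] lies in
[V = {v in A | v U is contained in A}].  As [A] is a flat, so are its
translates, and [U] and [V] are intersections of such translates, hence flats.
Since [J] and [Y] are independent, Hall's condition follows from the inequality
[r U + r V <= r A] for flats [U], [V] contained in [A] with [U V] contained in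
[A] ([nrank_product_le]).

That inequality is the matroid form of the Kemperman-Scherk theorem (finite
sets [U' = U + {1}] and [V' = V + {1}] of an abelian group in whose product [1]
is represented only once satisfy [#|U' V'| >= #|U'| + #|V'| - 1]), and Scherk's
argument by Dyson transforms survives.  If [U] and [V] are disjoint it is
modularity.  Otherwise, for [e] in [U], replace [V] by the flat
[V2 = V & e^-1 U] and [U] by the flat of all [u] in [A] with [u V2] contained
in [A], which contains both [U] and [e V].  By modularity and translation
invariance, [r U + r V = r (U | e V) + r V2], so the sum of ranks does not
decrease; and [r V2 < r V] unless [e V] is contained in [U].  Some [e] in [U]
escapes this exception: if none did, then any [x] common to [U] and [V] would
satisfy [x U = U] by equality of ranks, and [x] in [x U] would put [1] in [U],
hence in [A]. *)

(** * Hall's marriage theorem *)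

Section Hall.
Context (S T : choiceType).
Implicit Types (J X : {fset S}) (R : S -> {fset T}).
Local Open Scope fset_scope.

Definition neighbours R J : {fset T} := \bigcup_(x <- J) R x.

Definition hall_condition R X :=
  forall J, J `<=` X -> (#|` J| <= #|` neighbours R J|)%N.

Lemma neighboursP R J y :
  reflect (exists2 x, x \in J & y \in R x) (y \in neighbours R J).
Proof.
apply: (iffP (bigfcupP _ _ _ _)) => -[x]; first by rewrite andbT; exists x.
by exists x => //; rewrite andbT.
Qed.

(** The argument of Halmos and Vaughan: by induction on the size of [X],
either some proper nonempty part has exactly as many neighbours as elements,
and the problem splits along it, or every such part has a neighbour to spare,
and one element can be matched arbitrarily. *)
Lemma hall (t0 : T) R X : hall_condition R X ->
  exists f : S -> T, {in X &, injective f} /\ {in X, forall x, f x \in R x}.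
Proof.
have [n] := ubnP #|` X|; elim: n X R => // n IH X R; rewrite ltnS => Xn hallX.
have [->|[x0 x0X]] := fset_0Vmem X; first by exists (fun=> t0).
have [[J [JX J0 JnX tight]]|loose] := pselect (exists J,
    [/\ J `<=` X, J != fset0, J != X & #|` neighbours R J| = #|` J|]).
- (* match J inside its own neighbours; the rest keeps the condition once these
     are removed, as one sees by counting the neighbours of K together with J *)
  have ltJ : (#|` J| < #|` X|)%N by rewrite fproper_ltn_card // fproperEneq JnX.
  have [||f [finj fR]] := IH J R.
  + exact: leq_trans Xn.
  + by move=> K KJ; apply: hallX; apply: fsubset_trans JX.
  pose R' x := R x `\` neighbours R J.
  have [||g [ginj gR]] := IH (X `\` J) R'.
  + apply: leq_trans Xn.
    rewrite fproper_ltn_card // fproperEneq fsubsetDl andbT.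
    apply: contraNneq J0 => XJ; rewrite -fsubset0; apply/fsubsetP => x xJ.
    by move: (fsubsetP JX _ xJ); rewrite -XJ inE xJ.
  + move=> K KXJ.
    have /hallX : K `|` J `<=` X.
      by rewrite fsubUset JX andbT (fsubset_trans KXJ) ?fsubsetDl.
    have KJ0 : K `&` J = fset0.
      apply/fsetP => x; rewrite !inE; apply/negP => /andP[/(fsubsetP KXJ)].
      by rewrite inE => /andP[/negP].
    have -> : neighbours R (K `|` J) = neighbours R' K `|` neighbours R J.
      apply/fsetP => y; rewrite inE; apply/neighboursP/orP => [[x]|].
        rewrite inE => /orP[xK yx|xJ yx]; last first.
          by right; apply/neighboursP; exists x.
        have [|yJ] := boolP (y \in neighbours R J); first by right.
        by left; apply/neighboursP; exists x => //; rewrite inE yJ.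
      case=> /neighboursP[x xK]; last by exists x => //; rewrite inE xK orbT.
      by rewrite inE => /andP[_ ?]; exists x => //; rewrite inE xK.
    have := cardfsUI K J; rewrite KJ0 cardfs0 addn0 => ->.
    have := cardfsUI (neighbours R' K) (neighbours R J); rewrite tight.
    have -> : neighbours R' K `&` neighbours R J = fset0.
      apply/fsetP => y; rewrite inE; apply/negP => /andP[/neighboursP[x _]].
      by rewrite inE => /andP[/negP].
    by rewrite cardfs0 addn0 => ->; rewrite leq_add2r.
  have fN x : x \in J -> f x \in neighbours R J.
    by move=> xJ; apply/neighboursP; exists x => //; exact: fR.
  have gN x : x \in X -> x \notin J -> g x \notin neighbours R J.
    by move=> xX xJ; have := gR x; rewrite !inE xX xJ => /(_ isT)/andP[].
  exists (fun x => if x \in J then f x else g x); split=> [x y xX yX|x xX].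
    case: ifPn => xJ; case: ifPn => yJ.
    * exact: finj.
    * by move=> fg; have := gN _ yX yJ; rewrite -fg fN.
    * by move=> gf; have := gN _ xX xJ; rewrite gf fN.
    * by apply: ginj; rewrite inE ?xJ ?yJ.
  case: ifPn => [/fR//|xJ]; have := gR x; rewrite !inE xX xJ => /(_ isT).
  by case/andP.
(* no proper part is tight, so any choice for x0 leaves the condition true *)
have [y yx0] : exists y, y \in R x0.
  have := hallX [fset x0]; rewrite fsub1set x0X cardfs1 => /(_ isT).
  rewrite cardfs_gt0 => /fset0Pn[y /neighboursP[x]]; rewrite inE => /eqP ->.
  by exists y.
pose R' x := R x `\ y.
have [||g [ginj gR]] := IH (X `\ x0) R'.
- by apply: leq_trans Xn; rewrite [in X in (_ < X)%N](cardfsD1 x0) x0X.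
- move=> J JX; have [->|J0] := eqVneq J fset0; first by rewrite cardfs0.
  have JX' : J `<=` X by apply: fsubset_trans JX _; exact: fsubD1set.
  have : (#|` J| < #|` neighbours R J|)%N.
    rewrite ltn_neqAle hallX // andbT; apply/eqP => tight.
    apply: loose; exists J; split=> //; apply: contraTneq x0X => JXe.
    apply/negP => x0X; have := fsubsetP JX x0; rewrite JXe => /(_ x0X).
    by rewrite !inE eqxx.
  rewrite (cardfsD1 y) => h.
  have -> : neighbours R' J = neighbours R J `\ y.
    apply/fsetP => z; rewrite !inE; apply/neighboursP/andP => [[x xJ]|[zy]].
      by rewrite !inE => /andP[-> ?]; split=> //; apply/neighboursP; exists x.
    by case/neighboursP=> x xJ zx; exists x => //; rewrite !inE zy.
  rewrite -ltnS; apply: leq_trans h _; rewrite -add1n leq_add2r.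
  by case: (_ \in _).
have gy x : x \in X -> x != x0 -> (g x != y) && (g x \in R x).
  by move=> xX xx0; have := gR x; rewrite !inE xx0 xX => /(_ isT).
exists (fun x => if x == x0 then y else g x); split=> [x z xX zX|x xX].
  case: eqVneq => [->|xx0]; case: eqVneq => [->|zx0] //.
  - by move=> yg; have := gy _ zX zx0; rewrite -yg eqxx.
  - by move=> gx; have := gy _ xX xx0; rewrite gx eqxx.
  - by apply: ginj; rewrite !inE ?xx0 ?zx0.
by case: eqVneq => [->//|xx0]; have /andP[] := gy _ xX xx0.
Qed.

End Hall.

(** * Finite ranks as natural numbers *)

Section MatroidRank.
Context (E : choiceType) (M : finitary_matroid E).
Implicit Types (A B C X Y Z : set E).

(** The value is the rank only at sets of finite rank, since [fset_set] is
empty on infinite sets. *)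
Definition nrank A : nat := #|` fset_set (rank M A)|.

Lemma card_fset_setE A : finite_set A -> (A #= `I_(#|` fset_set A|))%card.
Proof.
by case/finite_setP=> n An; rewrite (card_fset_set An).
Qed.

Lemma sub_card_eq A B : finite_set B -> A `<=` B ->
  (#|` fset_set B| <= #|` fset_set A|)%N -> A = B.
Proof.
move=> finB AB BA; have finA := sub_finite_set AB finB.
apply: fset_set_inj => //; apply/eqP; rewrite eqEfcard BA andbT.
by rewrite -fset_set_sub.
Qed.

Lemma exists_card_sub (n : nat) (W : {fset E}) : (n <= #|` W|)%N ->
  exists2 V : {fset E}, (V `<=` W)%fset & #|` V| = n.
Proof.
move=> nW; exists [fset x in take n W]%fset.
  by apply/fsubsetP => x; rewrite inE => /mem_take.
by rewrite card_fseq undup_id ?take_uniq// size_takel.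
Qed.

(** The augmentation axiom asks for sizes differing by one; a larger [W] is cut
down to that size beforehand. *)
Lemma augment_of_ltn X (W : {fset E}) : indep M X -> finite_set X ->
  indep M [set` W] -> (#|` fset_set X| < #|` W|)%N ->
  exists2 x, x \in W /\ ~ X x & indep M (x |` X).
Proof.
move=> MX finX MW /exists_card_sub[V /fsubsetP VW cardV].
have MV : indep M [set` V] by apply: indep_subset MW _ => x /VW.
have [||x [Vx Xx] MxX] := indep_augment MX MV (n := #|` fset_set X|).
- exact: card_fset_setE.
- by rewrite -cardV -[in X in `I_X](set_fsetK V); apply: card_fset_setE.
- by exists x => //; split=> //; exact: VW.
Qed.

(** An independent subset of [A] larger than the basis [X] would augment [X]
inside [A].  This is applied to finite subsets of [Z], so that it also excludes
an infinite [Z]. *)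
Lemma card_indep_le_basis A X Z :
  is_basis M A X -> finite_set X -> indep M Z -> Z `<=` A ->
  finite_set Z /\ (#|` fset_set Z| <= #|` fset_set X|)%N.
Proof.
move=> [XA MX Xmax] finX MZ ZA.
have leX (W : {fset E}) : [set` W] `<=` Z -> (#|` W| <= #|` fset_set X|)%N.
  move=> WZ; rewrite leqNgt; apply/negP => /augment_of_ltn.
  case=> //; first exact: indep_subset MZ _.
  move=> x [Wx Xx] MxX; apply: Xx.
  have <- : x |` X = X.
    by apply: Xmax => // y [->|/XA//]; apply/ZA/WZ.
  by left.
have finZ : finite_set Z.
  apply: contrapT => /(infinite_set_fset #|` fset_set X|.+1)[W WZ].
  by rewrite ltnNge leX.
by split=> //; apply: leX; rewrite fset_setK.
Qed.

Section FiniteRank.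
Context (A : set E) (finA : finite_rank M A).

Lemma card_indep_le_nrank Z : indep M Z -> Z `<=` A ->
  finite_set Z /\ (#|` fset_set Z| <= nrank A)%N.
Proof. exact: card_indep_le_basis (rankP M A) finA. Qed.

Lemma finite_basis X : is_basis M A X -> finite_set X.
Proof. by case=> XA MX _; have [] := card_indep_le_nrank MX XA. Qed.

Lemma card_basis X : is_basis M A X -> #|` fset_set X| = nrank A.
Proof.
move=> bX; have finX := finite_basis bX; have [XA MX _] := bX.
apply/eqP; rewrite eqn_leq (card_indep_le_nrank MX XA).2.
have [rA Mr _] := rankP M A.
by have [_ ->] := card_indep_le_basis bX finX Mr rA.
Qed.

Lemma basis_of_card X : indep M X -> X `<=` A ->
  (nrank A <= #|` fset_set X|)%N -> is_basis M A X.
Proof.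
move=> MX XA leX; split=> // Y MY YA XY.
have [finY leY] := card_indep_le_nrank MY YA.
by apply/esym/sub_card_eq => //; exact: leq_trans leX.
Qed.

Lemma finite_rank_sub B : B `<=` A -> finite_rank M B.
Proof.
move=> BA; have [rB Mr _] := rankP M B.
by have [] := card_indep_le_nrank Mr (subset_trans rB BA).
Qed.

Lemma nrank_sub B : B `<=` A -> (nrank B <= nrank A)%N.
Proof.
move=> BA; have [rB Mr _] := rankP M B.
by have [] := card_indep_le_nrank Mr (subset_trans rB BA).
Qed.

Lemma extend_to_basis Z : indep M Z -> Z `<=` A ->
  exists2 X, is_basis M A X & Z `<=` X.
Proof.
have [n] := ubnP (nrank A - #|` fset_set Z|)%N.
elim: n Z => // n IH Z; rewrite ltnS => Zn MZ ZA.
have [finZ leZ] := card_indep_le_nrank MZ ZA.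
have [|ltZ] := leqP (nrank A) #|` fset_set Z|.
  by move=> h; exists Z => //; exact: basis_of_card.
have [rA Mr _] := rankP M A.
have [|x [Ax Zx] MxZ] := augment_of_ltn MZ finZ _ ltZ.
  by rewrite fset_setK.
have finxZ : finite_set (x |` Z) by rewrite finite_setU; split.
have [| | |X bX xZX] := IH (x |` Z) => //.
- apply: leq_trans Zn; rewrite fset_setU1 // cardfsU1.
  by rewrite in_fset_set // memNset // add1n subnS prednK // subn_gt0.
- by move=> y [->|/ZA//]; apply: rA; move: Ax; rewrite in_fset_set // inE.
- by exists X => // z Zz; apply: xZX; right.
Qed.

End FiniteRank.

Lemma nrank_set0 : nrank set0 = 0%N.
Proof.
rewrite /nrank; have [r0 _ _] := rankP M set0.
by move: r0; rewrite subset0 => ->; rewrite fset_set0 cardfs0.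
Qed.

Lemma sub_cl A : A `<=` cl M A.
Proof. by move=> x; left. Qed.

Lemma cl_mono A B : A `<=` B -> cl M A `<=` cl M B.
Proof.
move=> AB x [/AB|[_ [C [MC CA xC]]]]; first by left.
have [Bx|Bx] := pselect (B x); [by left|right; split=> //].
by exists C; split=> //; exact: subset_trans AB.
Qed.

Lemma flat_bigcap I (P : set I) (F : I -> set E) :
  (forall i, P i -> flat M (F i)) -> flat M (\bigcap_(i in P) F i).
Proof.
move=> flatF; apply/seteqP; split=> [x clx i Pi|]; last exact: sub_cl.
by rewrite -flatF //; apply: cl_mono clx => y; exact.
Qed.

Lemma flatI A B : flat M A -> flat M B -> flat M (A `&` B).
Proof.
move=> fA fB; rewrite -bigcap2E; apply: flat_bigcap => -[|[|n]] //= _.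
by apply/seteqP; split=> //; exact: sub_cl.
Qed.

(** A basis of [A] is large enough to be a basis of [B], so every element of
[B] depends on it. *)
Lemma flat_sub_eq A B : finite_rank M B -> flat M A -> A `<=` B ->
  (nrank B <= nrank A)%N -> A = B.
Proof.
move=> finB flatA AB leBA; have [rA Mr _] := rankP M A.
have [_ _ maxr] : is_basis M B (rank M A).
  by apply: basis_of_card => //; exact: subset_trans AB.
apply/seteqP; split=> // x Bx; rewrite -flatA.
have [Ax|Ax] := pselect (A x); [by left|right; split=> //].
exists (rank M A); split=> // MxA; apply/Ax/rA.
have <- : x |` rank M A = rank M A.
  by apply: maxr => // y [->|/rA/AB].
by left.
Qed.

Lemma card_card_sum X Y : finite_set X -> finite_set Y ->
  finite_set (Defs.card_sum X Y) /\
  #|` fset_set (Defs.card_sum X Y)| = (#|` fset_set X| + #|` fset_set Y|)%N.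
Proof.
move=> finX finY.
have fl : finite_set (inl @` X : set (E + E)) by exact: finite_image.
have fr : finite_set (inr @` Y : set (E + E)) by exact: finite_image.
split; first by rewrite finite_setU.
rewrite fset_setU // -[LHS]addn0 -(@cardfs0 (E + E)%type).
have <- : (fset_set (inl @` X : set (E + E)) `&` fset_set (inr @` Y))%fset
    = fset0.
  apply/fsetP => u; rewrite inE !in_fset_set // inE.
  by apply/negP => /andP[/set_mem[x _ <-] /set_mem[]].
rewrite cardfsUI !fset_set_image // !card_imfset //; by [move=> ? ? []].
Qed.

Lemma nrankUI A B C : modular M -> finite_rank M C ->
  flat M A -> flat M B -> A `<=` C -> B `<=` C ->
  (nrank A + nrank B = nrank (A `|` B) + nrank (A `&` B))%N.
Proof.
move=> modM finC flatA flatB AC BC.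
have fA := finite_rank_sub finC AC; have fB := finite_rank_sub finC BC.
have fU : finite_rank M (A `|` B).
  by apply: (finite_rank_sub finC); rewrite subUset.
have fI : finite_rank M (A `&` B).
  by exact: (finite_rank_sub fA (@subIsetl _ _ _)).
have [f1 e1] := card_card_sum fA fB; have [f2 e2] := card_card_sum fU fI.
by rewrite /nrank -e1 -e2; apply/fcard_eq => //; exact: modM.
Qed.

End MatroidRank.

(** * Translates of flats *)

Section Translation.
Context (G : groupType) (M : finitary_matroid G).
Context (invM : is_independence_group M).
Implicit Types (g : G) (A V X : set G).

Notation translate g V := [set g * x | x in V].

Lemma translateK g V : translate g^-1 (translate g V) = V.
Proof.
apply/seteqP; split=> [_ [_ [x Vx <-] <-]|x Vx]; first by rewrite mulKg.
by exists (g * x); [exists x|rewrite mulKg].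
Qed.

Lemma basis_translate g V X :
  is_basis M V X -> is_basis M (translate g V) (translate g X).
Proof.
move=> [XV MX Xmax]; split; first exact: image_subset.
  exact/invM.
move=> Y MY YV XY; rewrite -[Y](translateK g^-1) invgK; congr image.
apply: Xmax; first exact/invM.
  by rewrite -(translateK g V); exact: image_subset.
by rewrite -(translateK g X); exact: image_subset.
Qed.

Lemma nrank_translate g V :
  finite_rank M V -> nrank M (translate g V) = nrank M V.
Proof.
move=> finV; have bV := basis_translate g (rankP M V).
have fingr : finite_set (translate g (rank M V)) by exact: finite_image.
have [rgV Mr _] := rankP M (translate g V).
have [fingV _] := card_indep_le_basis bV fingr Mr rgV.
rewrite -(card_basis fingV bV) fset_set_image // card_imfset //.
exact: mulgI.
Qed.

Lemma flat_translate g V : flat M V -> flat M (translate g V).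
Proof.
move=> flatV; apply/seteqP; split=> [x|]; last exact: sub_cl.
case=> // -[_ [B [MB BV xB]]]; exists (g^-1 * x); last by rewrite mulVKg.
rewrite -flatV; have [Vx|Vx] := pselect (V (g^-1 * x)); first by left.
right; split=> //.
exists (translate g^-1 B); split; first exact/invM.
  by rewrite -(translateK g V); exact: image_subset.
by move=> MxB; apply: xB; apply/(invM g^-1); rewrite image_setU image_set1.
Qed.

End Translation.

(** * Products of flats inside a flat avoiding 1 *)

Section ProductBound.
Context (G : groupType) (M : finitary_matroid G).
Context (mulC : forall x y : G, x * y = y * x) (invM : is_independence_group M).
Context (modM : modular M).
Context (A : set G) (flatA : flat M A) (finA : finite_rank M A).
Implicit Types (J U V : set G).

Definition multipliers J : set G := A `&` [set x | forall a, J a -> A (x * a)].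

Lemma multipliers_sub J : multipliers J `<=` A.
Proof. exact: subIsetl. Qed.

(** For [a] in [J], the condition [x * a] in [A] says that [x] lies in the
translate [a^-1 A]. *)
Lemma flat_multipliers J : flat M (multipliers J).
Proof.
have -> : multipliers J = A `&` \bigcap_(a in J) [set a^-1 * x | x in A].
  congr (A `&` _); apply/seteqP; split=> x xJ a Ja.
    by exists (x * a); [exact: xJ|rewrite (mulC x) mulKg].
  by have [y Ay <-] := xJ a Ja; rewrite mulC mulVKg.
by apply: flatI => //; apply: flat_bigcap => a _; exact: flat_translate.
Qed.

(** Induction on the rank of [V] by the Dyson transform at an element [e] of [U]
that does not multiply [V] into [U]; where [U] and [V] meet, the absence of [1]
from [A] provides such an [e]. *)
Lemma nrank_product_le U V : ~ A 1 -> flat M U -> flat M V ->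
    U `<=` A -> V `<=` A -> (forall u v, U u -> V v -> A (u * v)) ->
  (nrank M U + nrank M V <= nrank M A)%N.
Proof.
move=> A1; have [n] := ubnP (nrank M V); elim: n U V => // n IH U V.
rewrite ltnS => Vn flatU flatV UA VA UVA.
have [UV0|/set0P[x [Ux Vx]]] := eqVneq (U `&` V) set0.
  by rewrite (nrankUI modM finA) // UV0 nrank_set0 addn0 nrank_sub // subUset.
have finU := finite_rank_sub finA UA; have finV := finite_rank_sub finA VA.
have [e [Ue eVU]] : exists e, U e /\ ~ [set e * v | v in V] `<=` U.
  apply: contrapT => noe.
  (* multiplication by e in U sends x back into U, as x is also in V *)
  have xUU : [set x * u | u in U] `<=` U.
    move=> _ [u Uu <-]; apply: contrapT => xuU; apply: noe.
    exists u; split=> // /(_ (x * u)) h.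
    by apply/xuU/h; exists x => //; rewrite mulC.
  have xUE : [set x * u | u in U] = U.
    apply: (flat_sub_eq finU) => //; first exact: flat_translate.
    by rewrite nrank_translate.
  have [u Uu xu] : [set x * u | u in U] x by rewrite xUE.
  by apply/A1/UA; rewrite -(mulKg x u) xu mulVg in Uu.
pose eV := [set e * v | v in V].
have flateV : flat M eV by exact: flat_translate.
have eVA : eV `<=` A by move=> _ [v Vv <-]; exact: UVA.
pose V' := [set e^-1 * u | u in U] `&` V.
have flatV' : flat M V' by apply: flatI => //; exact: flat_translate.
have V'V : V' `<=` V by exact: subIsetr.
have rV' : nrank M (U `&` eV) = nrank M V'.
  rewrite -(nrank_translate invM e (finite_rank_sub finV V'V)).
  congr nrank; apply/seteqP; split=> [y [Uy [v Vv evy]]|].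
    by exists v => //; split=> //; exists y => //; rewrite -evy mulKg.
  by move=> _ [v [[u Uu uv] Vv] <-]; split; [rewrite -uv mulVKg|exists v].
have ltV' : (nrank M V' < nrank M V)%N.
  rewrite ltnNge; apply/negP => /flat_sub_eq V'E; apply: eVU => _ [v + <-].
  by rewrite -V'E // => -[[u Uu <-] _]; rewrite mulVKg.
have : (nrank M (multipliers V') + nrank M V' <= nrank M A)%N.
  apply: IH => //; [exact: leq_trans Vn|exact: flat_multipliers|..].
  - exact: multipliers_sub.
  - exact: subset_trans VA.
  - by move=> u v [_]; exact.
apply: leq_trans; rewrite -(nrank_translate invM e finV).
rewrite (nrankUI modM finA) // rV' leq_add2r; apply: nrank_sub.
  exact: (finite_rank_sub finA (@multipliers_sub _)).
move=> y [Uy|[v Vv <-]]; split; [exact: UA|move=> a /V'V; exact: UVA|..].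
  by apply: eVA; exists v.
move=> _ [[u Uu <-] _]; rewrite [e * v]mulC -mulgA mulVKg mulC.
exact: UVA.
Qed.

(** The elements of [Y] without a partner in [J] are independent in
[U = multipliers J], and [J] is independent in [multipliers U], so both are
counted by [nrank_product_le]. *)
Lemma hall_condition_avoiding X Y : ~ A 1 -> is_basis M A X -> is_basis M A Y ->
  hall_condition (fun a => [fset y in fset_set Y | ~~ `[< A (a * y) >]]%fset)
    (fset_set X).
Proof.
move=> A1 bX bY J JX; have finX := finite_basis finA bX.
have finY := finite_basis finA bY; have [XA MX _] := bX; have [YA MY _] := bY.
pose U := multipliers [set` J]; pose V := multipliers U.
have JX' : [set` J] `<=` X.
  by move=> a /(fsubsetP JX); rewrite in_fset_set // inE.
have UVA : (nrank M U + nrank M V <= nrank M A)%N.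
  apply: nrank_product_le => //; try exact: multipliers_sub.
  - exact: flat_multipliers.
  - exact: flat_multipliers.
  - by move=> u v Uu [_ /(_ u Uu)]; rewrite mulC.
have JV : (#|` J| <= nrank M V)%N.
  rewrite -(set_fsetK J); apply: (card_indep_le_nrank _ _ _).2 => //.
  - exact: (finite_rank_sub finA (@multipliers_sub _)).
  - exact: indep_subset JX'.
  - by move=> a Ja; split=> [|u [_ /(_ a Ja)]]; [exact/XA/JX'|rewrite mulC].
set N := neighbours _ _.
have YNU : (#|` fset_set Y `\` N|%fset <= nrank M U)%N.
  rewrite -(set_fsetK (fset_set Y `\` N)%fset).
  have YNY : [set` (fset_set Y `\` N)%fset] `<=` Y.
    by move=> y /=; rewrite inE in_fset_set // => /andP[_ /set_mem].
  apply: (card_indep_le_nrank _ _ _).2 => //.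
  - exact: (finite_rank_sub finA (@multipliers_sub _)).
  - exact: indep_subset YNY.
  - move=> y yN; split=> [|a Ja]; first exact/YA/YNY.
    apply: contrapT => Aya; move: yN; rewrite /= inE => /andP[/negP + yY].
    apply; apply/neighboursP; exists a => //; rewrite !inE yY.
    by apply/asboolPn; rewrite mulC.
have NY : (N `<=` fset_set Y)%fset.
  by apply/fsubsetP => y /neighboursP[a _]; rewrite !inE => /andP[].
rewrite -(leq_add2r (nrank M U)) addnC.
apply: leq_trans (_ : nrank M U + nrank M V <= _)%N; first by rewrite leq_add2l.
apply: leq_trans UVA _; rewrite -(card_basis finA bY).
rewrite -(subnKC (fsubset_leq_card NY)) -(cardfsDS NY).
by rewrite leq_add2l.
Qed.

Lemma self_matched_of_notin : ~ A 1 -> self_matched M A.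
Proof.
move=> A1; split=> // X Y bX bY.
have finX := finite_basis finA bX; have finY := finite_basis finA bY.
have [f [finj fR]] := hall 1 (hall_condition_avoiding A1 bX bY).
have memX a : X a -> a \in fset_set X by move=> Xa; rewrite in_fset_set // inE.
have fY a : X a -> Y (f a) /\ ~ A (a * f a).
  move=> /memX/fR; rewrite !inE in_fset_set // => /andP[/set_mem Yfa].
  by move=> /asboolPn.
have injf : set_inj X f.
  by move=> a b /set_mem/memX aX /set_mem/memX bX'; exact: finj.
exists f; split=> [|a /fY[]//]; split=> //; first by move=> a /fY[].
have fXY : f @` X `<=` Y by move=> _ [a /fY[Yfa _] <-].
suff -> : Y = f @` X by [].
apply/esym/sub_card_eq => //; rewrite fset_set_image // card_in_imfset //.
by rewrite (card_basis finA bX) (card_basis finA bY).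
Qed.

(** In a basis through [1] the element matched to [1] violates the matching
condition. *)
Lemma notin_of_self_matched : indep M [set 1] -> self_matched M A -> ~ A 1.
Proof.
move=> M1 [_ _ matchA] A1.
have [|X bX /(_ 1 erefl) X1] := extend_to_basis finA M1.
  by move=> _ ->.
have [f [[_ _ fsurj] favoid]] := matchA X X bX bX.
have [a Xa fa1] := fsurj 1 X1; apply: (favoid a Xa).
by rewrite fa1 mulg1; have [XA _ _] := bX; exact: XA.
Qed.

End ProductBound.

(** * Self-matched flats *)

(** Some singleton is independent, and translations act transitively. *)
Lemma indep_set1 (G : groupType) (M : finitary_matroid G) (g : G) :
  is_independence_group M -> (exists2 X : set G, indep M X & X !=set0) ->
  indep M [set g].
Proof.
move=> invM [X MX [x Xx]].
have Mx : indep M [set x] by apply: indep_subset MX _ => _ ->.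
by have /invM := Mx => /(_ (g * x^-1)); rewrite image_set1 mulgVK.
Qed.

(* M_nontrivial excludes exactly the rank-zero matroid, whose only independent
   set is empty: there the whole group is a flat of finite rank that contains 1
   and is vacuously self-matched. *)
Theorem theorem7p2 (G : groupType) (M : finitary_matroid G)
    (G_abelian : forall x y : G, x * y = y * x)
    (M_indep_group : is_independence_group M)
    (M_modular : modular M)
    (M_nontrivial : exists2 X : set G, indep M X & X !=set0)
    (A : set G) (A_flat : flat M A) (A_finite_rank : finite_rank M A) :
  self_matched M A <-> ~ A 1.
Proof.
split; last exact: self_matched_of_notin.
exact: notin_of_self_matched (indep_set1 1 M_indep_group M_nontrivial).
Qed.
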